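(* Let $a,b\in\mathbb{H}$. Then in $\mathbb{O}$: (a) $e_4a=\overline{a}e_4$; (b) $e_4(ae_4)=-\overline{a}$; (c) $(ae_4)e_4=-a$; (d) $a(be_4)=(ba)e_4$; (e) $(ae_4)b=(a\overline{b})e_4$; (f) $(ae_4)(be_4)=-\overline{b}a$.
   Context: $\mathbb{H}$ denotes the quaternions with conjugation $a\mapsto\overline{a}$. The octonions $\mathbb{O}$ are $\mathbb{H}\oplus\mathbb{H}$ with the multiplication $(a,b)(c,d)=(ac-\overline{d}b,\ da+b\overline{c})$. A quaternion $a$ is identified with $(a,0)\in\mathbb{O}$, and $e_4=(0,1)$. *)

(* Defs.v *)
From HB Require Import structures.
From mathcomp Require Import all_boot all_order all_algebra.
From mathcomp Require Import ring reals.

Set Implicit Arguments.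
Unset Strict Implicit.
Unset Printing Implicit Defensive.

Import GRing.Theory.
Local Open Scope ring_scope.

Declare Scope octonion_scope.
Delimit Scope octonion_scope with Oct.

Reserved Notation "x *o y" (at level 40, left associativity).
Reserved Notation "a %:O" (at level 1, left associativity, format "a %:O").

(* [Quat a b c d] is a + b i + c j + d k. *)
Record quaternion (R : Type) : Type := Quat { qre : R; qi : R; qj : R; qk : R }.

Definition tuple_of_quat (R : Type) (x : quaternion R) : R * R * R * R :=
  (qre x, qi x, qj x, qk x).
Definition quat_of_tuple (R : Type) (t : R * R * R * R) : quaternion R :=
  Quat t.1.1.1 t.1.1.2 t.1.2 t.2.
Lemma tuple_of_quatK (R : Type) :
  cancel (@tuple_of_quat R) (@quat_of_tuple R).
Proof. by case. Qed.

HB.instance Definition _ (R : eqType) :=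
  Equality.copy (quaternion R) (can_type (@tuple_of_quatK R)).
HB.instance Definition _ (R : choiceType) :=
  Choice.copy (quaternion R) (can_type (@tuple_of_quatK R)).

Section QuaternionRing.
Variable R : comNzRingType.
Implicit Types x y z : quaternion R.

Definition addq x y :=
  Quat (qre x + qre y) (qi x + qi y) (qj x + qj y) (qk x + qk y).
Definition oppq x := Quat (- qre x) (- qi x) (- qj x) (- qk x).

Lemma addqA : associative addq.
Proof. by move=> x y z; rewrite /addq /= !addrA. Qed.
Lemma addqC : commutative addq.
Proof. by move=> x y; congr Quat; rewrite addrC. Qed.
Lemma add0q : left_id (Quat 0 0 0 0) addq.
Proof. by case=> a b c d; rewrite /addq /= !add0r. Qed.
Lemma addNq : left_inverse (Quat 0 0 0 0) oppq addq.
Proof. by move=> x; rewrite /addq /= !addNr. Qed.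

HB.instance Definition _ :=
  GRing.isZmodule.Build (quaternion R) addqA addqC add0q addNq.

(* Hamilton's product: i^2 = j^2 = k^2 = ijk = -1. *)
Definition mulq x y :=
  Quat (qre x * qre y - qi x * qi y - qj x * qj y - qk x * qk y)
       (qre x * qi y + qi x * qre y + qj x * qk y - qk x * qj y)
       (qre x * qj y - qi x * qk y + qj x * qre y + qk x * qi y)
       (qre x * qk y + qi x * qj y - qj x * qi y + qk x * qre y).

Lemma mulqA : associative mulq.
Proof. by move=> x y z; congr Quat => /=; ring. Qed.
Lemma mul1q : left_id (Quat 1 0 0 0) mulq.
Proof. by case=> a b c d; congr Quat => /=; ring. Qed.
Lemma mulq1 : right_id (Quat 1 0 0 0) mulq.
Proof. by case=> a b c d; congr Quat => /=; ring. Qed.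
Lemma mulqDl : left_distributive mulq +%R.
Proof. by move=> x y z; congr Quat => /=; ring. Qed.
Lemma mulqDr : right_distributive mulq +%R.
Proof. by move=> x y z; congr Quat => /=; ring. Qed.
Lemma oneq_neq0 : Quat 1 0 0 0 != 0 :> quaternion R.
Proof. by apply/eqP => -[] /eqP; rewrite oner_eq0. Qed.

HB.instance Definition _ := GRing.Zmodule_isNzRing.Build (quaternion R)
  mulqA mul1q mulq1 mulqDl mulqDr oneq_neq0.

Definition conjq x : quaternion R := Quat (qre x) (- qi x) (- qj x) (- qk x).

End QuaternionRing.

(* A dedicated pair type: the product type [quaternion R * quaternion R]
   already carries the componentwise ring structure. *)
Record octonion (R : Type) : Type :=
  Oct { ofst : quaternion R; osnd : quaternion R }.

Definition pair_of_oct (R : Type) (x : octonion R) := (ofst x, osnd x).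
Definition oct_of_pair (R : Type) (p : quaternion R * quaternion R) :=
  Oct p.1 p.2.
Lemma pair_of_octK (R : Type) : cancel (@pair_of_oct R) (@oct_of_pair R).
Proof. by case. Qed.

HB.instance Definition _ (R : eqType) :=
  Equality.copy (octonion R) (can_type (@pair_of_octK R)).
HB.instance Definition _ (R : choiceType) :=
  Choice.copy (octonion R) (can_type (@pair_of_octK R)).

Section OctonionAlgebra.
Variable R : comNzRingType.
Implicit Types (x y z : octonion R) (a b : quaternion R).

Definition addo x y := Oct (ofst x + ofst y) (osnd x + osnd y).
Definition oppo x := Oct (- ofst x) (- osnd x).

Lemma addoA : associative addo.
Proof. by move=> x y z; rewrite /addo /= !addrA. Qed.
Lemma addoC : commutative addo.
Proof. by move=> x y; congr Oct; rewrite addrC. Qed.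
Lemma add0o : left_id (Oct 0 0) addo.
Proof. by case=> a b; rewrite /addo /= !add0r. Qed.
Lemma addNo : left_inverse (Oct 0 0) oppo addo.
Proof. by move=> x; rewrite /addo /= !addNr. Qed.

HB.instance Definition _ :=
  GRing.isZmodule.Build (octonion R) addoA addoC add0o addNo.

(* Not associative, hence no ring structure on [octonion R]. *)
Definition mulo x y : octonion R :=
  let: Oct a b := x in let: Oct c d := y in
  Oct (a * c - conjq d * b) (d * a + b * conjq c).

Definition oct_of_quat a : octonion R := Oct a 0.

Definition e4 : octonion R := Oct 0 1.

End OctonionAlgebra.

Arguments e4 {R}.

Notation "x *o y" := (mulo x y) : octonion_scope.
Notation "a %:O" := (oct_of_quat a) : octonion_scope.

(* The identification of a with (a, 0) respects the ring operations. *)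
Lemma oct_of_quatN (R : comNzRingType) (a : quaternion R) :
  ((- a)%:O = - a%:O :> octonion R)%Oct%R.
Proof. by congr Oct; rewrite oppr0. Qed.

Lemma oct_of_quatM (R : comNzRingType) (a b : quaternion R) :
  (oct_of_quat (a * b) = a%:O *o b%:O)%Oct.
Proof.
by congr Oct; rewrite ?mulr0 ?mul0r ?subr0 ?addr0.
Qed.

(* Main.v *)
Require Import Defs.
From mathcomp Require Import all_boot all_order all_algebra.
From mathcomp Require Import reals.

(** Right multiplication by [e4] carries the quaternion [a], that is
    [(a, 0)], to the octonion [(0, a)] ([mulo_quat_e4]).  The octonions are thus
    graded by Z/2, with the quaternions in even degree and the [(0, a)] in odd
    degree, and the multiplication rule reduces on homogeneous elements to
    a single quaternion product: [mulo_even_odd], [mulo_odd_even] and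
    [mulo_odd_odd].  Since [e4] is [(0, 1)] and the conjugation fixes [1], each
    of the six identities is an instance of one of these three rules.  The order
    of the quaternion factors matters throughout, while associativity of the
    octonion product is never available. *)

Import GRing.Theory.

Local Open Scope ring_scope.
Local Open Scope octonion_scope.

Lemma conjq0 (R : comNzRingType) : conjq 0 = 0 :> quaternion R.
Proof. by congr Quat; rewrite /= oppr0. Qed.

Lemma conjq1 (R : comNzRingType) : conjq 1 = 1 :> quaternion R.
Proof. by congr Quat; rewrite /= oppr0. Qed.

Section HomogeneousProducts.
Variable R : comNzRingType.
Implicit Types a b : quaternion R.

Lemma mulo_even_odd a b : a%:O *o Oct 0 b = Oct 0 (b * a).
Proof. by congr Oct; rewrite ?mulr0 ?mul0r ?subr0 ?addr0. Qed.

Lemma mulo_odd_even a b : Oct 0 a *o b%:O = Oct 0 (a * conjq b).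
Proof. by congr Oct; rewrite ?conjq0 !mul0r ?subr0 ?add0r. Qed.

(** Odd times odd is even, so only the term [- conjq d * b] of the
    Cayley-Dickson formula survives; it produces every sign in the theorem. *)
Lemma mulo_odd_odd a b : Oct 0 a *o Oct 0 b = - (conjq b * a)%:O.
Proof.
rewrite -oct_of_quatN; congr Oct; first by rewrite mul0r sub0r.
by rewrite conjq0 !mulr0 addr0.
Qed.

Lemma mulo_quat_e4 a : a%:O *o e4 = Oct 0 a.
Proof. by rewrite mulo_even_odd mul1r. Qed.

End HomogeneousProducts.

Theorem lemma2p9 (R : realType) (a b : quaternion R) :
  (e4 *o a%:O = (conjq a)%:O *o e4) /\
  (e4 *o (a%:O *o e4) = - (conjq a)%:O) /\
  ((a%:O *o e4) *o e4 = - a%:O) /\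
  (a%:O *o (b%:O *o e4) = (b * a)%:O *o e4) /\
  ((a%:O *o e4) *o b%:O = (a * conjq b)%:O *o e4) /\
  ((a%:O *o e4) *o (b%:O *o e4) = - (conjq b * a)%:O).
Proof.
rewrite !mulo_quat_e4 /e4; do !split.
- by rewrite mulo_odd_even mul1r.
- by rewrite mulo_odd_odd mulr1.
- by rewrite mulo_odd_odd conjq1 mul1r.
- exact: mulo_even_odd.
- exact: mulo_odd_even.
- exact: mulo_odd_odd.
Qed.
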